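(* In the unknown IID stochastic arrival model, for online submodular welfare maximization with configurations and post-allocation stochasticity (as defined in the context), non-adaptive Greedy is $(1-1/e)$-competitive against $\mathrm{AOPT}$: its expected value (over the random arrival sequence) is at least $(1-1/e)$ times the expected value of $\mathrm{AOPT}$.
   Context: There is a set $I$ of resources and a finite set $T$ of arrival types, with a probability distribution $\mathcal{V}$ over $T$ unknown to the online algorithm. There are $V$ arrivals; the type $t_v$ of each arrival $v\in[V]$ is drawn independently from $\mathcal{V}$ and revealed on arrival. For each type $t$ there is a set $N_t$ of configurations $(R,t)$, $R\subseteq I$; $N=\bigcup_tN_t$; each arrival $v$ may be assigned at most one configuration from $N_{t_v}$, and several arrivals of the same type may receive the same configuration, so allocations are multisets of configurations. Each resource $i$ has an objective $f_i$ defined on such multisets (the lattice of non-negative integer vectors), monotone, with $f_i(\emptyset)=0$, depending only on configurations containing $i$, and satisfying the diminishing returns property: $f_i(x+e_k)-f_i(x)\le f_i(y+e_k)-f_i(y)$ whenever $x\ge y$ coordinatewise and $e_k$ is a unit vector. Post-allocation stochasticity: when a configuration $e=(R,t)$ is chosen, each $i\in R$ is active with probability $p_{i,e}$, independently across different arrivals; the realized reward is $\sum_i f_i(X_i)$ with $X_i$ the multiset of chosen configurations in which $i$ was active. $F_i(S)$ denotes the expected value of $f_i$ of the active part of $S$ for $i$ when $S$ is chosen. Non-adaptive Greedy: at arrival $v$, with $\mathrm{ALG}(v)$ its previous choices, it chooses a configuration in $\arg\max_{e\in N_{t_v}}\sum_iF_i(e\mid\mathrm{ALG}(v))$, where $F(e\mid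 S)=F(S+e)-F(S)$, without observing activity outcomes. $\mathrm{AOPT}$ is the optimal offline policy that knows the types of all arrivals, is non-anticipative with respect to the activity outcomes (observes them only after choosing a configuration) and may adapt to observed outcomes. *)

(* Defs.v *)
From HB Require Import structures.
From mathcomp Require Import all_boot all_order all_algebra.
From mathcomp Require Import classical_sets boolp reals.

Set Implicit Arguments.
Unset Strict Implicit.
Unset Printing Implicit Defensive.

Import Order.TTheory GRing.Theory Num.Theory.
Local Open Scope ring_scope.

Definition is_pmf (R : realType) (S : finType) (P : S -> R) : Prop :=
  (forall s, 0 <= P s) /\ \sum_(s : S) P s = 1.

(* Configurations are the pairs (R, t) belonging to a given set N;
   N_t consists of those whose second component is t. *)
Notation config N := {e | e \in N}.

Definition config_of_type (I T : finType) (N : {set {set I} * T}) (t : T) :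
    {set config N} :=
  [set e | (val e).2 == t].

Section MultisetFunctions.
Context {R : realType} {E : finType}.
Implicit Types (h : {ffun E -> nat} -> R) (x y : {ffun E -> nat}) (k : E).

Definition mset0 : {ffun E -> nat} := [ffun=> 0%N].

Definition mset_add x k : {ffun E -> nat} := [ffun e => (x e + (e == k))%N].

Definition mset_le x y : Prop := forall e, (x e <= y e)%N.

Definition mset_monotone h : Prop := forall x y, mset_le x y -> h x <= h y.

Definition diminishing_returns h : Prop :=
  forall x y k, mset_le y x ->
    h (mset_add x k) - h x <= h (mset_add y k) - h y.

End MultisetFunctions.

(* An adaptive offline policy, as a decision tree: either stop, or assign the
   configuration e to arrival v, then observe the set of resources of e that
   are active, and continue depending on that set.  Arrivals may be processed
   in any (adaptively chosen) order and may be left unassigned. *)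
Inductive policy (V : nat) (I : finType) (E : Type) : Type :=
| Stop
| Assign (v : 'I_V) (e : E) (next : {set I} -> policy V I E).

Arguments Stop {V I E}.
Arguments Assign {V I E} v e next.

Section Model.
Context {R : realType} {I T : finType} {N : {set {set I} * T}}.

Definition depends_on_own (i : I) (h : {ffun config N -> nat} -> R) : Prop :=
  forall x y : {ffun config N -> nat},
    (forall e : config N, i \in (val e).1 -> x e = y e) -> h x = h y.

(* act e is the joint law of the set of active resources when e is chosen.
   Only its marginals p i e are prescribed: activities of different resources
   at the same arrival may be correlated, those at different arrivals are
   independent (see F and policy_value). *)
Definition activity_law (p : I -> config N -> R)
    (act : config N -> {set I} -> R) : Prop :=
  forall e : config N,
    [/\ is_pmf (act e),
        forall A : {set I}, ~~ (A \subset (val e).1) -> act e A = 0 &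
        forall i, i \in (val e).1 -> \sum_(A : {set I} | i \in A) act e A = p i e].

Variables (act : config N -> {set I} -> R) (f : I -> {ffun config N -> nat} -> R).

(* An outcome lists the chosen configurations together with the set of
   resources active in each of them. *)
Definition active_part (i : I) (o : seq (config N * {set I})) :
    {ffun config N -> nat} :=
  [ffun e => count (fun c : config N * {set I} => (c.1 == e) && (i \in c.2)) o].

Definition reward (o : seq (config N * {set I})) : R :=
  \sum_(i : I) f i (active_part i o).

(* The multiset S is given by a list of its elements; the order is
   immaterial. *)
Definition F (i : I) (S : seq (config N)) : R :=
  \sum_(A : (size S).-tuple {set I})
    (\prod_(j < size S) act (tnth (in_tuple S) j) (tnth A j)) *
    f i (active_part i (zip S A)).

Definition gain (e : config N) (S : seq (config N)) : R :=
  \sum_(i : I) (F i (rcons S e) - F i S).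

(* A non-adaptive online rule maps the types of the arrivals so far, the
   current one last, to the decision for the current arrival.  choices g ts
   collects its decisions along the arrival sequence ts. *)
Definition choices (g : seq T -> option (config N)) (ts : seq T) :
    seq (config N) :=
  pmap (fun v => g (take v.+1 ts)) (iota 0 (size ts)).

(* Ties may be broken arbitrarily, depending on the history of types. *)
Definition is_greedy (g : seq T -> option (config N)) : Prop :=
  forall (ts : seq T) (t : T),
    match g (rcons ts t) with
    | Some e => e \in config_of_type N t /\
        forall e', e' \in config_of_type N t ->
          gain e' (choices g ts) <= gain e (choices g ts)
    | None => config_of_type N t = finset.set0
    end.

Section Offline.
Variables (V : nat) (tau : V.-tuple T).

(* used is the set of arrivals already processed. *)
Fixpoint feasible (used : {set 'I_V}) (pi : policy V I (config N)) : Prop :=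
  match pi with
  | Stop => True
  | Assign v e next =>
      [/\ v \notin used, e \in config_of_type N (tnth tau v) &
          forall A, feasible (v |: used)%SET (next A)]
  end.

Fixpoint policy_value (pi : policy V I (config N))
    (o : seq (config N * {set I})) : R :=
  match pi with
  | Stop => reward o
  | Assign v e next =>
      \sum_(A : {set I}) act e A * policy_value (next A) (rcons o (e, A))
  end.

Definition offline_values : set R :=
  [set policy_value pi [::] | pi in feasible finset.set0]%classic.

Definition AOPT : R := sup offline_values.

End Offline.

End Model.

Definition iid_expectation (R : realType) (T : finType) (D : T -> R) (V : nat)
    (X : V.-tuple T -> R) : R :=
  \sum_(tau : V.-tuple T) (\prod_(v < V) D (tnth tau v)) * X tau.

(* The supremum defining AOPT is a genuine one. *)
Lemma offline_values_has_sup (R : realType) (I T : finType)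
    (N : {set {set I} * T}) (p : I -> config N -> R)
    (act : config N -> {set I} -> R) (f : I -> {ffun config N -> nat} -> R)
    (V : nat) (tau : V.-tuple T) :
  activity_law p act -> (forall i, mset_monotone (f i)) ->
  has_sup (offline_values act f tau).
Proof.
move=> hact hmono; split; first by exists (reward f [::]); exists Stop.
pose M := \sum_i f i [ffun=> V].
suff H pi : forall used o, feasible tau used pi -> (size o <= #|used|)%N ->
    policy_value act f pi o <= M.
  by exists M => _ [pi hpi <-]; apply: (H pi finset.set0).
elim: pi => [|v e next IH] used o /=.
  move=> _ ho; apply: ler_sum => i _; apply: hmono => e; rewrite !ffunE.
  apply: leq_trans (count_size _ _) _; apply: leq_trans ho _.
  by rewrite -[leqRHS](card_ord V) max_card.
move=> [vu _ hn] ho; have [[act0 act1] _ _] := hact e.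
rewrite -[leRHS]mul1r -act1 mulr_suml; apply: ler_sum => A _.
apply: ler_wpM2l => //; apply: (IH A (v |: used)%SET) => //.
by rewrite size_rcons cardsU1 vu.
Qed.

(* Main.v *)
Require Import Defs.
From mathcomp Require Import all_boot all_order all_algebra.
From mathcomp Require Import reals sequences exp.
From mathcomp Require Import lra.

Import Order.TTheory GRing.Theory Num.Theory.
Local Open Scope ring_scope.

Set Implicit Arguments.
Unset Strict Implicit.

(** Fix the multiset S chosen by Greedy so far.  Running any offline policy on
    top of S, with an independent copy of the activities of S, only increases
    its value, and by diminishing returns each arrival v then contributes at
    most the greedy gain of its type over S.  Averaging over the arrivals gives
    E AOPT <= F S + V * E_t (greedy gain of t over S), so one step of Greedy
    closes a fraction 1/V of the gap to E AOPT in expectation, and the gap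
    left after V steps is at most (1 - 1/V)^V <= 1/e of E AOPT. *)

(** * Expectations over tuples with independent coordinates *)

Section TupleExpectation.
Context {R : realType} {X : finType}.

(** The weights [W] are indexed by all of [nat] so that they stay fixed in inductions on [n]. A
    constant [W] gives [iid_expectation]; weights varying with [j] serve for the activities of a
    list of configurations. *)
Definition tuple_expectation (n : nat) (W : nat -> X -> R)
    (G : n.-tuple X -> R) : R :=
  \sum_(A : n.-tuple X) (\prod_(j < n) W j (tnth A j)) * G A.

Arguments tuple_expectation n W G : clear implicits.
Implicit Types (n : nat) (W : nat -> X -> R).

Lemma tuple_expectation0 W (G : 0.-tuple X -> R) :
  tuple_expectation 0 W G = G [tuple].
Proof.
rewrite /tuple_expectation (bigD1 [tuple]) //= big_ord0 mul1r.
by rewrite big1 ?addr0 // => A; rewrite (tuple0 A) => /eqP.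
Qed.

(** The last coordinate is the one split off because histories of types and of outcomes grow at the
    end, by [rcons]. The sum is reindexed along the bijection sending (A, x) to [rcons A x]. *)
Lemma tuple_expectationS n W (G : n.+1.-tuple X -> R) :
  tuple_expectation n.+1 W G =
  tuple_expectation n W (fun A => \sum_x W n x * G [tuple of rcons A x]).
Proof.
rewrite /tuple_expectation.
under [RHS]eq_bigr do rewrite mulr_sumr.
rewrite pair_bigA /=.
pose h (u : n.-tuple X * X) : n.+1.-tuple X := [tuple of rcons u.1 u.2].
pose k (A : n.+1.-tuple X) : n.-tuple X * X :=
  ([tuple of belast (thead A) (behead A)], last (thead A) (behead A)).
have kK A : h (k A) = A.
  by apply: val_inj; rewrite /= -lastI; case: A => -[].
have h_inj : injective h.
  move=> [A x] [B y] /(congr1 val)/rcons_inj[eqAB ->].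
  by congr (_, _); apply: val_inj.
rewrite (reindex h) /=; last by exists k => u _; [apply: h_inj; rewrite kK|].
apply: eq_bigr => -[A x] _ /=.
rewrite big_ord_recr /= -mulrA; congr (_ * (_ * _)).
- apply: eq_bigr => j _; congr (W _ _).
  by rewrite !(tnth_nth x) /= nth_rcons size_tuple ltn_ord.
- by rewrite (tnth_nth x) /= nth_rcons size_tuple ltnn eqxx.
Qed.

Lemma eq_tuple_expectation n W (G G' : n.-tuple X -> R) :
  G =1 G' -> tuple_expectation n W G = tuple_expectation n W G'.
Proof. by move=> eqG; apply: eq_bigr => A _; rewrite eqG. Qed.

Lemma tuple_expectationD n W (G G' : n.-tuple X -> R) :
  tuple_expectation n W (fun A => G A + G' A) =
  tuple_expectation n W G + tuple_expectation n W G'.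
Proof. by rewrite -big_split; apply: eq_bigr => A _; rewrite mulrDr. Qed.

Lemma tuple_expectationZ n W (a : R) (G : n.-tuple X -> R) :
  tuple_expectation n W (fun A => a * G A) = a * tuple_expectation n W G.
Proof. by rewrite mulr_sumr; apply: eq_bigr => A _; rewrite mulrCA. Qed.

Lemma tuple_expectation_sum (J : finType) n W (G : J -> n.-tuple X -> R) :
  tuple_expectation n W (fun A => \sum_j G j A) =
  \sum_j tuple_expectation n W (G j).
Proof. by rewrite exchange_big; apply: eq_bigr => A _; rewrite mulr_sumr. Qed.

Lemma ler_tuple_expectation n W (G G' : n.-tuple X -> R) :
  (forall j x, 0 <= W j x) -> (forall A, G A <= G' A) ->
  tuple_expectation n W G <= tuple_expectation n W G'.
Proof.
move=> W0 leG; apply: ler_sum => A _; apply: ler_wpM2l => //.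
exact: prodr_ge0.
Qed.

Lemma tuple_expectation_cst n W (a : R) :
  (forall j, (j < n)%N -> \sum_x W j x = 1) ->
  tuple_expectation n W (fun=> a) = a.
Proof.
elim: n => [|n IHn] W1; first by rewrite tuple_expectation0.
rewrite tuple_expectationS -mulr_suml W1 // mul1r IHn // => j ltjn.
exact/W1/ltnW.
Qed.

(** Linearity of expectation: every coordinate has law [D], so the [n] terms have the same mean. *)
Lemma tuple_expectation_sum_coord n (D c : X -> R) :
  \sum_x D x = 1 ->
  tuple_expectation n (fun=> D) (fun A => \sum_(j < n) c (tnth A j)) =
  n%:R * \sum_x D x * c x.
Proof.
move=> D1; under eq_tuple_expectation do rewrite -(big_tuple _ _ _ predT).
elim: n => [|n IHn]; first by rewrite tuple_expectation0 big_nil mul0r.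
rewrite tuple_expectationS.
transitivity (tuple_expectation n (fun=> D)
    (fun A => \sum_(y <- A) c y + \sum_x D x * c x)).
  apply: eq_tuple_expectation => A.
  under eq_bigr do rewrite /= -cats1 big_cat big_seq1 mulrDr.
  by rewrite big_split -mulr_suml D1 mul1r.
rewrite tuple_expectationD IHn tuple_expectation_cst //.
by rewrite -natr1 mulrDl mul1r.
Qed.

End TupleExpectation.

Arguments tuple_expectation {R X} n W G.

(** * Rewards, policies and gains averaged over independent activities *)

Section Gap.
Context {R : realType} {I T : finType} {N : {set {set I} * T}}.
Variables (p : I -> config N -> R) (act : config N -> {set I} -> R).
Hypothesis hact : activity_law p act.
Variable f : I -> {ffun config N -> nat} -> R.
Hypothesis f_mono : forall i, mset_monotone (f i).
Hypothesis f_dr : forall i, diminishing_returns (f i).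

Local Notation outcome := (seq (config N * {set I})).
Implicit Types (S : seq (config N)) (e : config N) (z o : outcome).

Lemma act_ge0 e A : 0 <= act e A.
Proof. by have [[]] := hact e. Qed.

Lemma act_sum1 e : \sum_A act e A = 1.
Proof. by have [[]] := hact e. Qed.

(** The default of [nth] is not reached below [size S]; being zero, it keeps the weights nonnegative
    at every index, as [ler_tuple_expectation] asks. *)
Definition outcome_expectation S (G : outcome -> R) : R :=
  tuple_expectation (size S) (nth (fun=> 0) [seq act e | e <- S])
    (fun A => G (zip S A)).

Lemma outcome_expectation_rcons S e G :
  outcome_expectation (rcons S e) G =
  outcome_expectation S (fun z => \sum_A act e A * G (rcons z (e, A))).
Proof.
rewrite /outcome_expectation size_rcons tuple_expectationS.
apply: eq_bigr => A _; congr (_ * _).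
- apply: eq_bigr => j _.
  by rewrite map_rcons nth_rcons size_map ltn_ord.
- apply: eq_bigr => x _.
  by rewrite map_rcons nth_rcons size_map ltnn eqxx /= zip_rcons ?size_tuple.
Qed.

Lemma outcome_expectation_nil G : outcome_expectation [::] G = G [::].
Proof. exact: tuple_expectation0. Qed.

Lemma outcome_expectationD S (G G' : outcome -> R) :
  outcome_expectation S (fun z => G z + G' z) =
  outcome_expectation S G + outcome_expectation S G'.
Proof. exact: tuple_expectationD. Qed.

Lemma ler_outcome_expectation S (G G' : outcome -> R) :
  (forall z, G z <= G' z) ->
  outcome_expectation S G <= outcome_expectation S G'.
Proof.
move=> leG; apply: ler_tuple_expectation => // j A.
elim: S j => [|e S IHS] [|j] //=; exact: act_ge0.
Qed.

Lemma outcome_expectation_cst S (a : R) : outcome_expectation S (fun=> a) = a.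
Proof.
apply: tuple_expectation_cst => j ltjS.
elim: S j ltjS => [|e S IHS] [|j] //= ltjS; [exact: act_sum1|exact: IHS].
Qed.

Lemma F_outcome_expectation i S :
  F act f i S = outcome_expectation S (fun z => f i (active_part i z)).
Proof.
apply: eq_bigr => A _; congr (_ * _); apply: eq_bigr => j _.
by case: S A j => [|e S] A j; [case: j|rewrite (nth_map e) // (tnth_nth e)].
Qed.

Lemma sum_F S : \sum_i F act f i S = outcome_expectation S (reward f).
Proof.
under eq_bigr do rewrite F_outcome_expectation.
by rewrite -tuple_expectation_sum.
Qed.

Lemma sum_FB_gain e S :
  gain act f e S = \sum_i F act f i (rcons S e) - \sum_i F act f i S.
Proof. by rewrite -sumrB. Qed.

Lemma active_part_rcons i o e A :
  active_part i (rcons o (e, A)) =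
  if i \in A then mset_add (active_part i o) e else active_part i o.
Proof.
apply/ffunP => e'; rewrite (fun_if (fun x : {ffun _ -> nat} => x e')) !ffunE.
rewrite -cats1 count_cat; move: (count _ o) => n /=.
by rewrite addn0 eq_sym; case: (i \in A); rewrite ?andbT ?andbF ?addn0.
Qed.

Lemma active_part_cat i z o e :
  active_part i (z ++ o) e = (active_part i z e + active_part i o e)%N.
Proof. by rewrite !ffunE count_cat. Qed.

Lemma ler_reward o o' :
  (forall i, mset_le (active_part i o) (active_part i o')) ->
  reward f o <= reward f o'.
Proof. by move=> leo; apply: ler_sum => i _; apply: f_mono. Qed.

Lemma mset_le_rcons o o' x :
  (forall i, mset_le (active_part i o) (active_part i o')) ->
  forall i, mset_le (active_part i (rcons o x)) (active_part i (rcons o' x)).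
Proof.
by move=> leo i e; rewrite -!cats1 !active_part_cat leq_add2r; apply: leo.
Qed.

Lemma reward_diminishing z o x :
  (forall i, mset_le (active_part i z) (active_part i o)) ->
  reward f (rcons o x) - reward f o <= reward f (rcons z x) - reward f z.
Proof.
case: x => e A lezo; rewrite -!sumrB; apply: ler_sum => i _.
by rewrite !active_part_rcons; case: ifP => _; [apply: f_dr|rewrite !subrr].
Qed.

Lemma ler_policy_value V (pi : policy V I (config N)) o o' :
  (forall i, mset_le (active_part i o) (active_part i o')) ->
  policy_value act f pi o <= policy_value act f pi o'.
Proof.
elim: pi o o' => [|v e next IH] o o' leo /=; first exact: ler_reward.
apply: ler_sum => A _; apply: ler_wpM2l; first exact: act_ge0.
exact/IH/mset_le_rcons.
Qed.

(** In this form diminishing returns apply outcome by outcome. The activity [A] of [e] is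
    independent of [z] and has total mass one, so [reward f z] can be moved inside the sum over
    [A]. *)
Lemma gain_outcome_expectation e S :
  gain act f e S = outcome_expectation S
    (fun z => \sum_A act e A * (reward f (rcons z (e, A)) - reward f z)).
Proof.
rewrite sum_FB_gain !sum_F outcome_expectation_rcons.
apply/eqP; rewrite subr_eq; apply/eqP; rewrite -tuple_expectationD.
apply: eq_tuple_expectation => A /=.
rewrite -[X in _ + X]mul1r -(act_sum1 e) mulr_suml -big_split /=.
by apply: eq_bigr => B _; rewrite -mulrDr subrK.
Qed.

Lemma gain_ge0 e S : 0 <= gain act f e S.
Proof.
rewrite gain_outcome_expectation -[leLHS](outcome_expectation_cst S 0).
apply: ler_outcome_expectation => z; apply: sumr_ge0 => A _.
apply: mulr_ge0; first exact: act_ge0.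
rewrite subr_ge0; apply: ler_reward => i e'.
by rewrite -cats1 active_part_cat leq_addr.
Qed.

(** * Upper bound on the offline optimum from a fixed multiset *)

Section Offline.
Variables (V : nat) (tau : V.-tuple T) (S : seq (config N)) (c : T -> R).
Hypothesis c_ge0 : forall t, 0 <= c t.
Hypothesis gain_le :
  forall t e, e \in config_of_type N t -> gain act f e S <= c t.

(** Induction on the decision tree, with [z] the independent outcome of [S] and [o] the history of
    the policy. The marginal of [(e, A)] over [z ++ o] is at most that over [z], whose mean is the
    gain of [e] over [S]. An arrival is charged to [c] only when it enters [used]; those left over
    at [Stop] are covered by [c_ge0]. *)
Lemma policy_value_cat_le (pi : policy V I (config N)) used o :
  feasible tau used pi ->
  outcome_expectation S (fun z => policy_value act f pi (z ++ o)) <=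
  outcome_expectation S (fun z => reward f (z ++ o)) +
    \sum_(v | v \notin used) c (tnth tau v).
Proof.
elim: pi used o => [|v e next IH] used o /=.
  by move=> _; rewrite lerDl; apply: sumr_ge0 => v _; apply: c_ge0.
move=> [v_free e_type feas_next].
set rest := \sum_(w | w \notin (v |: used)%SET) c (tnth tau w).
have -> : \sum_(w | w \notin used) c (tnth tau w) = c (tnth tau v) + rest.
  rewrite (bigD1 v) //=; congr (_ + _); apply: eq_bigl => w.
  by rewrite !inE negb_or andbC.
(* The induction hypothesis bounds each branch [A] separately; [rest] does not depend on [A], so
   averaging over [A] leaves it unchanged. *)
have step : outcome_expectation S (fun z => \sum_A act e A *
      policy_value act f (next A) (rcons (z ++ o) (e, A))) <=
    outcome_expectation S (fun z => \sum_A act e A *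
      reward f (rcons (z ++ o) (e, A))) + rest.
  rewrite -[rest]mul1r -(act_sum1 e) mulr_suml.
  rewrite /outcome_expectation !tuple_expectation_sum -big_split /=.
  apply: ler_sum => A _; rewrite !tuple_expectationZ -mulrDr.
  apply: ler_wpM2l; first exact: act_ge0.
  have := IH A _ (rcons o (e, A)) (feas_next A).
  rewrite /outcome_expectation.
  under eq_tuple_expectation do rewrite -rcons_cat.
  by under [in X in _ <= X -> _]eq_tuple_expectation do rewrite -rcons_cat.
apply: (le_trans step); rewrite addrA lerD2r.
apply: le_trans (lerD (lexx _) (gain_le e_type)).
rewrite gain_outcome_expectation -outcome_expectationD.
apply: ler_outcome_expectation => z.
rewrite -lerBlDl -[X in _ - X]mul1r -(act_sum1 e) mulr_suml -sumrB.
apply: ler_sum => A _; rewrite -mulrBr; apply: ler_wpM2l; first exact: act_ge0.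
by apply: reward_diminishing => i e'; rewrite active_part_cat leq_addr.
Qed.

Lemma AOPT_le : AOPT act f tau <= \sum_i F act f i S + \sum_v c (tnth tau v).
Proof.
apply: ge_sup; first by exists (reward f [::]); exists Stop.
move=> _ [pi feas_pi <-].
have cats0E (G : outcome -> R) :
    outcome_expectation S (fun z => G (z ++ [::])) = outcome_expectation S G.
  by apply: eq_tuple_expectation => A; rewrite cats0.
have := policy_value_cat_le [::] feas_pi.
rewrite (cats0E (policy_value act f pi)) (cats0E (reward f)) sum_F.
under [in X in _ <= _ + X -> _]eq_bigl do rewrite inE.
(* The value of the policy from the empty history is constant in [z], and by monotonicity starting
   from [z] instead can only raise it. *)
rewrite -[X in _ -> X <= _](outcome_expectation_cst S).
apply: le_trans; apply: ler_outcome_expectation => z.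
by apply: ler_policy_value => i e; rewrite !ffunE.
Qed.

End Offline.

(** * Progress of Greedy in one step and the recursion on the gap *)

Section Greedy.
Variable g : seq T -> option (config N).
Hypothesis hg : is_greedy act f g.

(** The decision at position [v] reads only the first [v.+1] types, so a further arrival leaves the
    earlier choices intact. *)
Lemma choices_rcons ts t :
  choices g (rcons ts t) =
  if g (rcons ts t) is Some e then rcons (choices g ts) e else choices g ts.
Proof.
rewrite /choices size_rcons -addn1 iotaD pmap_cat /= add0n.
rewrite -(size_rcons ts t) take_size.
rewrite (_ : pmap _ _ = pmap (fun v => g (take v.+1 ts)) (iota 0 (size ts))).
  by case: (g _) => [e|] /=; rewrite ?cats1 ?cats0.
have : {in iota 0 (size ts),
    (fun v => g (take v.+1 (rcons ts t))) =1 (fun v => g (take v.+1 ts))}.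
  by move=> v; rewrite mem_iota add0n => /andP[_ ltv]; rewrite -cats1 takel_cat.
elim: (iota _ _) => //= v s IHs eqg; rewrite eqg ?mem_head // IHs // => w ws.
by apply: eqg; rewrite inE ws orbT.
Qed.

Definition greedy_value ts : R := \sum_i F act f i (choices g ts).

Lemma greedy_gain_ge0 ts t : 0 <= greedy_value (rcons ts t) - greedy_value ts.
Proof.
rewrite /greedy_value choices_rcons; case: (g _) => [e|]; last by rewrite subrr.
by rewrite -sum_FB_gain gain_ge0.
Qed.

Lemma greedy_gain_max ts t e : e \in config_of_type N t ->
  gain act f e (choices g ts) <= greedy_value (rcons ts t) - greedy_value ts.
Proof.
move=> e_t; have := hg ts t; rewrite /greedy_value choices_rcons.
case: (g _) => [e'|] => [[_ /(_ e e_t)]|N0]; first by rewrite -sum_FB_gain.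
by rewrite N0 inE in e_t.
Qed.

Variables (V : nat) (D : T -> R).
Hypothesis hD : is_pmf D.

Let opt := iid_expectation D (fun tau : V.-tuple T => AOPT act f tau).
(** The horizon [k] of Greedy varies while that of [opt] stays [V]. *)
Let alg k :=
  tuple_expectation k (fun=> D) (fun ts : k.-tuple T => greedy_value ts).

(** The history [ts] is fixed and the arrivals [tau] of the benchmark are a fresh sample, so no
    coupling with the arrivals of Greedy is needed. The bound [c] on gains is the actual increment
    of Greedy at each type. *)
Lemma opt_le_greedy ts :
  opt <= greedy_value ts +
    V%:R * (\sum_t D t * greedy_value (rcons ts t) - greedy_value ts).
Proof.
have [D0 D1] := hD.
pose c t := greedy_value (rcons ts t) - greedy_value ts.
have -> : \sum_t D t * greedy_value (rcons ts t) - greedy_value ts =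
    \sum_t D t * c t.
  rewrite -[X in _ - X]mul1r -D1 mulr_suml -sumrB.
  by apply: eq_bigr => t _; rewrite mulrBr.
rewrite -(tuple_expectation_sum_coord V c D1).
rewrite -[X in X + _](@tuple_expectation_cst _ _ V (fun=> D)) //.
rewrite -tuple_expectationD; apply: ler_tuple_expectation => // tau.
apply: AOPT_le; [exact: greedy_gain_ge0|exact: greedy_gain_max].
Qed.

(** Averaging over histories of length [k]: the next type is independent of them, so it acts as the
    last coordinate in [alg k.+1]. *)
Lemma opt_le_step k : opt <= alg k + V%:R * (alg k.+1 - alg k).
Proof.
have [D0 D1] := hD.
rewrite -[leLHS](@tuple_expectation_cst _ _ k (fun=> D)) //.
apply: le_trans (ler_tuple_expectation _ (fun ts => opt_le_greedy ts)) _ => //.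
rewrite /alg tuple_expectationS -[X in _ <= _ + _ * (_ + X)]mulN1r.
rewrite -!(tuple_expectationZ, tuple_expectationD).
by under eq_tuple_expectation do rewrite -mulN1r.
Qed.

Lemma gap_le k : (0 < V)%N -> opt - alg k <= (1 - V%:R^-1) ^+ k * (opt - alg 0).
Proof.
move=> V_gt0; elim: k => [|k IHk]; first by rewrite mul1r.
have V_gt0R : 0 < V%:R :> R by rewrite ltr0n.
have step : opt - alg k.+1 <= (1 - V%:R^-1) * (opt - alg k).
  have := opt_le_step k; rewrite -lerBlDl -ler_pdivrMl //.
  lra.
apply: (le_trans step); rewrite exprS -mulrA; apply: ler_wpM2l => //.
by rewrite subr_ge0 invf_le1 // ler1n.
Qed.

End Greedy.

End Gap.

(** * The constant 1 - 1/e and the conclusion *)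

Lemma exprn_1BV_le (R : realType) (n : nat) : (0 < n)%N ->
  (1 - n%:R^-1) ^+ n <= (expR 1)^-1 :> R.
Proof.
move=> n_gt0; have n_gt0R : 0 < n%:R :> R by rewrite ltr0n.
(* Once 1/e is written as the [n]-th power of [expR (- n%:R^-1)], the bases compare by 1 + x <=
   [expR x] at x = -1/n. *)
rewrite -expRN -[X in expR X](_ : n%:R * - n%:R^-1 = -1); last first.
  by rewrite mulrN divff ?gt_eqF.
rewrite expRM_natl; apply: lerXn2r; rewrite ?nnegrE ?expR_ge0 ?expR_ge1Dx //.
by rewrite subr_ge0 invf_le1 // ler1n.
Qed.

Unset Implicit Arguments.

Theorem theorem4 (R : realType) (I T : finType) (N : {set {set I} * T})
    (p : I -> config N -> R) (act : config N -> {set I} -> R)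
    (hact : activity_law p act)
    (f : I -> {ffun config N -> nat} -> R)
    (f_mono : forall i, mset_monotone (f i))
    (f_0 : forall i, f i mset0 = 0)
    (f_own : forall i, depends_on_own i (f i))
    (f_dr : forall i, diminishing_returns (f i))
    (g : seq T -> option (config N)) (hg : is_greedy act f g)
    (V : nat) (D : T -> R) (hD : is_pmf D) :
  (1 - (expR 1)^-1) *
    iid_expectation D (fun tau : V.-tuple T => AOPT act f tau)
  <= iid_expectation D
       (fun tau : V.-tuple T => \sum_(i : I) F act f i (choices g tau)).
Proof.
have reward0 : reward f [::] = 0 by apply: big1 => i _; apply: f_0.
have alg0 : tuple_expectation 0 (fun=> D)
    (fun ts : 0.-tuple T => greedy_value act f g ts) = 0.
  rewrite tuple_expectation0 /greedy_value sum_F.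
  by rewrite outcome_expectation_nil.
(* The policy [Stop] earns 0. The sign is needed to replace the factor (1 - 1/V)^V by 1/e at the
   end. *)
have opt_ge0 : 0 <= iid_expectation D (fun tau : V.-tuple T => AOPT act f tau).
  apply: sumr_ge0 => tau _; apply: mulr_ge0.
    by apply: prodr_ge0 => v _; case: hD.
  apply: (ub_le_sup (offline_values_has_sup tau hact f_mono).2).
  by exists Stop.
have [V0|V_gt0] := posnP V.
  have := opt_le_step hact f_mono f_dr hg V hD 0.
  rewrite alg0; subst V; rewrite mul0r addr0 => opt_le0.
  have /eqP -> : iid_expectation D (fun tau : 0.-tuple T => AOPT act f tau) == 0.
    by rewrite eq_le opt_le0.
  by rewrite mulr0 -[leLHS]alg0; apply: lexx.
have := gap_le hact f_mono f_dr hg hD V V_gt0.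
rewrite alg0 subr0 => gap.
(* The goal is rearranged to bound the gap after [V] steps by 1/e times the optimum. *)
rewrite mulrBl mul1r lerBlDr -lerBlDl; apply: le_trans gap _.
by apply: ler_wpM2r => //; apply: exprn_1BV_le.
Qed.
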